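(* Let $(M,d)$ be a compact metric space and $0<\varepsilon\le\alpha$. The set of $[\varepsilon,\alpha]$-expansive homeomorphisms of $M$ is open in $\mathcal H(M)$.
   Context: A homeomorphism $f\colon M\to M$ is $[\varepsilon,\alpha]$-expansive if: $x,y\in M$ and $d(f^nx,f^ny)\le\alpha$ for all $n\in\mathbb Z$ implies $d(x,y)<\varepsilon$. $\mathcal H(M)$ is the space of homeomorphisms of $M$ with the compact-open topology, i.e. the topology induced by the metric $d_{C^0}(f,g)=\max\{d(f(x),g(x)):x\in M\}$. *)

(* Defs.v *)
From HB Require Import structures.
From mathcomp Require Import all_boot all_order all_algebra.
From mathcomp Require Import all_classical all_reals all_analysis.
From mathcomp Require Import lra.

Set Implicit Arguments.
Unset Strict Implicit.
Unset Printing Implicit Defensive.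

Import Order.TTheory GRing.Theory Num.Theory.
Import numFieldNormedType.Exports.

Local Open Scope classical_set_scope.
Local Open Scope ring_scope.

Record homeo (M : topologicalType) := Homeo {
  homeo_fun :> M -> M;
  homeo_inv : M -> M;
  homeo_funK : cancel homeo_fun homeo_inv;
  homeo_invK : cancel homeo_inv homeo_fun;
  homeo_fun_continuous : continuous homeo_fun;
  homeo_inv_continuous : continuous homeo_inv }.

(* The inverse is carried as data, but it is determined by the map. *)
Lemma homeo_fun_inj (M : topologicalType) : injective (@homeo_fun M).
Proof.
case=> f f' fK f'K fc f'c [g g' gK g'K gc g'c] /= fg.
have {fg} fg : f = g by [].
subst g; have f'g' : f' = g'.
  by apply/funext => x; rewrite -[in RHS](f'K x) gK.
by subst g'; congr Homeo; exact: Prop_irrelevance.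
Qed.

HB.instance Definition _ (M : topologicalType) := gen_eqMixin (homeo M).
HB.instance Definition _ (M : topologicalType) := gen_choiceMixin (homeo M).

(* H(M): the topology inherited from the compact-open topology on M -> M;
   open_homeoP below shows that, for M compact metric, it is the topology
   induced by dC0. *)
HB.instance Definition _ (M : topologicalType) :=
  Topological.copy (homeo M)
    (@initial_topology (homeo M) {compact-open, M -> M} (@homeo_fun M)).

Definition homeo_iter (M : topologicalType) (f : homeo M) (n : int) : M -> M :=
  match n with
  | Posz k => iter k f
  | Negz k => iter k.+1 (homeo_inv f)
  end.

Definition expansive (R : realType) (M : metricType R) (eps alpha : R)
    (f : homeo M) : Prop :=
  forall x y : M,
    (forall n : int, mdist (homeo_iter f n x) (homeo_iter f n y) <= alpha) ->
    mdist x y < eps.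

(* The supremum is a maximum when M is compact and nonempty (dC0_max), and is
   0 when M is empty. *)
Definition dC0 (R : realType) (M : metricType R) (f g : homeo M) : R :=
  sup [set mdist (f x) (g x) | x in [set: M]].

Section dC0_topology.
Context {R : realType} {M : metricType R}.
Implicit Types f g : homeo M.

Let mdist_dist (x y x' y' : M) :
  `|mdist x y - mdist x' y'| <= mdist x x' + mdist y y'.
Proof.
have := metric_triangle x x' y; have := metric_triangle x' y' y.
have := metric_triangle x' x y'; have := metric_triangle x y y'.
rewrite (metric_sym y' y) (metric_sym x' x) => h1 h2 h3 h4.
rewrite ler_norml; apply/andP; split; lra.
Qed.

Lemma continuous_mdist_homeo f g :
  continuous (fun x => mdist (f x) (g x)).
Proof.
move=> x; apply/cvgrPdist_lt => e e0.
have e20 : 0 < e / 2 by rewrite divr_gt0.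
have fx : \forall y \near x, mdist (f x) (f y) < e / 2.
  apply: metricType_numDomainType.cvgr_dist_lt e20.
  exact: homeo_fun_continuous.
have gx : \forall y \near x, mdist (g x) (g y) < e / 2.
  apply: metricType_numDomainType.cvgr_dist_lt e20.
  exact: homeo_fun_continuous.
apply: filterS2 fx gx => y fxy gxy.
apply: le_lt_trans (mdist_dist _ _ _ _) _.
by rewrite [e]splitr ltrD.
Qed.

Context (cptM : compact [set: M]).

Lemma dC0_max f g (x0 : M) : exists2 c : M, dC0 f g = mdist (f c) (g c) &
  forall x, mdist (f x) (g x) <= mdist (f c) (g c).
Proof.
have cfg : {within [set: M], continuous (fun x => mdist (f x) (g x))}.
  by apply: continuous_subspaceT => x; exact: continuous_mdist_homeo.
have [c _ cmax] := compact_EVT_max (ex_intro _ x0 I) cptM cfg.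
have {}cmax x : mdist (f x) (g x) <= mdist (f c) (g c).
  by apply: cmax; rewrite inE.
exists c => //; apply/eqP; rewrite eq_le; apply/andP; split.
  apply: ge_sup; first by exists (mdist (f c) (g c)), c.
  by move=> _ [x _ <-].
apply: ub_le_sup; last by exists c.
by exists (mdist (f c) (g c)) => _ [x _ <-].
Qed.

Lemma dC0_lt f g (r : R) : 0 < r ->
  dC0 f g < r <-> forall x, mdist (f x) (g x) < r.
Proof.
move=> r0; have [[x0]|M0] := pselect (inhabited M).
  have [c -> cmax] := dC0_max f g x0; split => [cr x|]; last exact.
  exact: le_lt_trans (cmax x) cr.
split=> [_ x|_]; first by have := M0 (inhabits x).
rewrite /dC0 (_ : [set _ | _ in _] = set0) ?sup0//.
by rewrite -subset0 => z [x]; have := M0 (inhabits x).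
Qed.

Lemma nbhs_homeoP f (A : set (homeo M)) :
  nbhs f A <-> exists2 r : R, 0 < r & [set g | dC0 f g < r] `<=` A.
Proof.
split.
- rewrite nbhsE => -[_ [[C oC <-] Cf] CA].
  have : nbhs (homeo_fun f : {uniform M -> M}) C.
    have : {compact-open, nbhs (homeo_fun f : {uniform M -> M}) --> homeo_fun f}.
      apply/compact_open_cvgP => K O cptK oO fKO.
      have := fam_compact_nbhs oO fKO cptK (@homeo_fun_continuous _ f).
      move=> fam; have : {family compact, nbhs (homeo_fun f : {uniform M -> M})
          --> homeo_fun f}.
        apply/fam_cvgP => D _.
        by apply: (uniform_subset_cvg (A := setT)) => //; exact: cvg_id.
      move=> /(_ _ fam); apply: filterS => g gO _ [y Ky <-]; exact: gO.
    by apply; apply: open_nbhs_nbhs.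
  move=> /uniform_nbhs[E [entE EC]].
  move: entE; rewrite -entourage_ballE => -[r /= r0 rE].
  exists r => // g /(dC0_lt _ _ r0) fgr; apply/CA/EC => y _.
  by apply: rE; rewrite /= ballEmdist; exact: fgr.
- move=> [r r0 rA].
  pose e := r / 4; have e0 : 0 < e by rewrite divr_gt0.
  pose N x := [set y | mdist (f x) (f y) < e].
  pose K x := [set y | mdist (f x) (f y) <= e].
  pose O x : set M := [set z | mdist (f x) z < e + e].
  have cdist x : continuous (fun z : M => mdist x z).
    move=> z; apply/cvgrPdist_lt => d d0.
    have : \forall y \near z, mdist z y < d.
      by apply: metricType_numDomainType.cvgr_dist_lt d0; exact: cvg_id.
    apply: filterS => y zy.
    by apply: le_lt_trans (mdist_dist _ _ _ _) _; rewrite mdistxx add0r.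
  have cdistf x : continuous (fun y => mdist (f x) (f y)).
    move=> y; apply: continuous_comp; [exact: homeo_fun_continuous|exact: cdist].
  have oN x : open (N x).
    by apply: (open_comp (D := [set t : R | t < e])) => // y _; exact: cdistf.
  have oO x : open (O x).
    by apply: (open_comp (D := [set t : R | t < e + e])) => // y _; exact: cdist.
  have cK x : compact (K x).
    apply: (subclosed_compact _ cptM) => //.
    have /continuous_closedP/(_ _ (@closed_le R e)) := cdistf x.
    exact.
  have fK x : f @` K x `<=` O x.
    by move=> _ [y /= Ky <-]; rewrite /O/= (le_lt_trans Ky)// ltrDl.
  have /compact_near_coveringP cov := cptM.
  have : nbhs f [set g : homeo M |
      [set: M] `<=` [set y | mdist (f y) (g y) < r]].
    apply: (cov _ (nbhs f) (fun (g : homeo M) y => mdist (f y) (g y) < r)).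
    move=> x _; exists (N x, [set g : homeo M | homeo_fun g @` K x `<=` O x]).
      split; apply: open_nbhs_nbhs; split.
      - exact: oN.
      - by rewrite /N/= mdistxx.
      - by exists [set h | h @` K x `<=` O x] => //; exact: compact_open_open.
      - exact: fK.
    move=> [y g] /= [Nxy gK].
    have Oxy : O x (g y) by apply: gK; exists y => //=; exact: ltW.
    have := metric_triangle (f y) (f x) (g y); rewrite (metric_sym (f y) (f x)).
    move: Nxy Oxy; rewrite /N /O /e /=; lra.
  by apply: filterS => g gr; apply/rA/dC0_lt => // y; exact: gr.
Qed.

Lemma open_homeoP (A : set (homeo M)) :
  open A <->
  forall f, A f -> exists2 r : R, 0 < r & [set g | dC0 f g < r] `<=` A.
Proof.
rewrite openE; split=> oA f /oA; by move=> /nbhs_homeoP.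
Qed.

End dC0_topology.

(* Main.v *)
(** Expansivity says that every pair [(x, y)] satisfies [mdist x y < eps] or has
    an integer [n] with [alpha < mdist (f^n x) (f^n y)].  Both alternatives are
    open conditions on the triple [(f, x, y)], because [(f, x) |-> f^n x] is
    jointly continuous; compactness of [M * M] then makes the condition open in
    [f] uniformly over all pairs. *)
Require Import Defs.
From mathcomp Require Import all_boot all_order all_algebra.
From mathcomp Require Import all_classical all_reals all_analysis.
From mathcomp Require Import lra.

Import Order.TTheory GRing.Theory Num.Theory.
Import numFieldNormedType.Exports.

Local Open Scope classical_set_scope.
Local Open Scope ring_scope.

Lemma continuous_mdist {R : realType} {M : metricType R} :
  continuous (fun p : M * M => mdist p.1 p.2).
Proof.
move=> [x y]; apply/cvgrPdist_lt => e e0 /=.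
have e20 : 0 < e / 2 by rewrite divr_gt0.
exists (ball x (e / 2), ball y (e / 2)); first by split; exact: nbhsx_ballx.
move=> [x' y'] /= []; rewrite !ballEmdist /= => xx' yy'.
(* These four triangle inequalities give [|d(x, y) - d(x', y')| <= d(x, x') + d(y, y')], and each
   term on the right is below [e / 2]. *)
have := metric_triangle x x' y; have := metric_triangle x' y' y.
have := metric_triangle x' x y'; have := metric_triangle x y y'.
rewrite (metric_sym y' y) (metric_sym x' x) ltr_norml => h1 h2 h3 h4.
apply/andP; split; lra.
Qed.

(** In [d(f x, g y) <= d(f x, f y) + d(f y, g y)] the first term is small by continuity of [f], the
    second because [dC0 f g] bounds it for every [y] at once. *)
Lemma continuous_homeo_eval {R : realType} {M : metricType R}
    (cptM : compact [set: M]) :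
  continuous (fun p : homeo M * M => p.1 p.2).
Proof.
move=> [f x]; apply/metricType_numDomainType.cvgrPdist_lt => e e0 /=.
have e20 : 0 < e / 2 by rewrite divr_gt0.
have fx : \forall y \near x, mdist (f x) (f y) < e / 2.
  apply: metricType_numDomainType.cvgr_dist_lt e20.
  exact: homeo_fun_continuous.
exists ([set g | dC0 f g < e / 2], [set y | mdist (f x) (f y) < e / 2]).
  by split=> //; apply/(nbhs_homeoP cptM); exists (e / 2).
move=> [g y] /= [/(dC0_lt cptM _ _ e20)/(_ y) fg fxy].
have := metric_triangle (f x) (f y) (g y); lra.
Qed.

(* If [f z <> x] then [g z' <> y] for all [(g, z', y)] close to [(f, z, x)]; by
   compactness of [M], a solution [z] of [g z = y] can then only lie in a
   prescribed neighbourhood of [f^-1 x]. *)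
Lemma continuous_homeo_inv_eval {R : realType} {M : metricType R}
    (cptM : compact [set: M]) :
  continuous (fun p : homeo M * M => homeo_inv p.1 p.2).
Proof.
move=> [f x] A; rewrite /= nbhsE => -[U [oU Ux] UA].
have /compact_near_coveringP cov := cptM.
have : nbhs (f, x) [set p : homeo M * M |
    [set: M] `<=` [set z | U z \/ 0 < mdist (p.1 z) p.2]].
  apply: (cov _ (nbhs (f, x))
    (fun (p : homeo M * M) z => U z \/ 0 < mdist (p.1 z) p.2)) => z _.
  have [Uz|nUz] := pselect (U z).
    exists (U, setT) => /=; last by move=> [z' p] /= [Uz' _]; left.
    by split; [exact: open_nbhs_nbhs | exact: filterT].
  have fzx : 0 < mdist (f z) x.
    rewrite mdist_gt0; apply/eqP => fzx; apply: nUz.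
    by rewrite -(homeo_funK f z) fzx.
  have cvg_eval : (fun q : M * (homeo M * M) => mdist (q.2.1 q.1) q.2.2)
      @ nbhs (z, (f, x)) --> mdist (f z) x.
    apply: (cvg_comp2 (f := fun q : M * (homeo M * M) => q.2.1 q.1)
      (g := fun q => q.2.2) (h := @mdist R M) _ _ (continuous_mdist (f z, x))).
    - apply: (cvg_comp2 (f := fun q : M * (homeo M * M) => q.2.1)
        (g := fun q => q.1) (h := fun (g : homeo M) => g : M -> M) _ _
        (continuous_homeo_eval cptM (f, z))).
      + apply: (cvg_comp snd fst); [exact: cvg_snd | exact: cvg_fst].
      + exact: cvg_fst.
    - apply: (cvg_comp snd snd); exact: cvg_snd.
  have [VW nVW VWgt] := cvgr_gt _ cvg_eval _ fzx.
  by exists VW => // q VWq; right; exact: (VWgt q VWq).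
apply: filterS => -[g y] /= /(_ (homeo_inv g y) I) [Ugy|]; first exact: UA.
by rewrite homeo_invK mdistxx ltxx.
Qed.

(** The family [phi] is left abstract so that one induction serves both the maps and their
    inverses. *)
Lemma continuous_iter_eval {T M : topologicalType} (phi : T -> M -> M) (k : nat) :
  continuous (fun p : T * M => phi p.1 p.2) ->
  continuous (fun p : T * M => iter k (phi p.1) p.2).
Proof.
move=> cphi; elim: k => [|k IHk] [t x] /=; first exact: cvg_snd.
apply: (cvg_comp2 (f := fst) (g := fun p : T * M => iter k (phi p.1) p.2)
  (h := phi) _ _ (cphi (t, iter k (phi t) x))).
- exact: cvg_fst.
- exact: (IHk (t, x)).
Qed.

Lemma continuous_homeo_iter_eval {R : realType} {M : metricType R}
    (cptM : compact [set: M]) (n : int) :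
  continuous (fun p : homeo M * M => homeo_iter p.1 n p.2).
Proof.
case: n => k.
- exact: (continuous_iter_eval (@homeo_fun M) k (continuous_homeo_eval cptM)).
(* [Negz k] stands for [-(k + 1)], hence [k.+1] iterations of the inverse. *)
- exact: (continuous_iter_eval (@homeo_inv M) k.+1
    (continuous_homeo_inv_eval cptM)).
Qed.

Theorem proposition2p6 (R : realType) (M : metricType R) (eps alpha : R)
    (cptM : compact [set: M]) (eps_gt0 : 0 < eps) (eps_le : eps <= alpha) :
  open [set f : homeo M | expansive eps alpha f].
Proof.
rewrite openE => f expf.
have /compact_near_coveringP cov : compact [set: M * M].
  by rewrite -setXTT; exact: compact_setX.
pose separated (g : homeo M) (p : M * M) := mdist p.1 p.2 < eps \/
  exists n, alpha < mdist (homeo_iter g n p.1) (homeo_iter g n p.2).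
have : nbhs f [set g | [set: M * M] `<=` separated g].
  (* By compactness it is enough to treat pairs near a fixed [(x, y)] together with [g] near [f]. *)
  apply: (cov _ (nbhs f) separated) => -[x y] _.
  have [xy|nxy] := pselect (mdist x y < eps).
    exists ([set p | mdist p.1 p.2 < eps], setT) => /=.
      split; last exact: filterT.
      exact: (cvgr_lt _ (continuous_mdist (x, y))).
    by move=> [p g] /= [pe _]; left.
  have [n fn] : exists n, alpha < mdist (homeo_iter f n x) (homeo_iter f n y).
    (* Contrapositive of expansivity: if no [n] separated the orbits beyond [alpha], then [x] and
       [y] would be [eps]-close. *)
    apply: contrapT => nfn; apply: nxy; apply: expf => n.
    by rewrite leNgt; apply/negP => fn; apply: nfn; exists n.
  have cvg_iter (pr : M * M -> M) : continuous pr ->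
      (fun q : (M * M) * homeo M => homeo_iter q.2 n (pr q.1))
      @ nbhs ((x, y), f) --> homeo_iter f n (pr (x, y)).
    move=> cpr.
    apply: (cvg_comp2 (f := snd) (g := fun q : (M * M) * homeo M => pr q.1)
      (h := fun g => homeo_iter g n) _ _
      (continuous_homeo_iter_eval cptM n (f, pr (x, y)))).
    - exact: cvg_snd.
    - apply: (cvg_comp fst pr); [exact: cvg_fst | exact: cpr].
  have cvg_mdist : (fun q : (M * M) * homeo M =>
        mdist (homeo_iter q.2 n q.1.1) (homeo_iter q.2 n q.1.2))
      @ nbhs ((x, y), f) --> mdist (homeo_iter f n x) (homeo_iter f n y).
    apply: cvg_comp2 (continuous_mdist (homeo_iter f n x, homeo_iter f n y)).
    - by apply: (cvg_iter fst) => p; exact: cvg_fst.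
    - by apply: (cvg_iter snd) => p; exact: cvg_snd.
  have [VW nVW VWgt] := cvgr_gt _ cvg_mdist _ fn.
  by exists VW => // q VWq; right; exists n; exact: (VWgt q VWq).
(* For such [g], orbits that stay within [alpha] rule out the second alternative, which leaves
   [mdist x y < eps]. *)
apply: filterS => g sep x y gxy.
have [//|[n]] := sep (x, y) I.
by rewrite ltNge gxy.
Qed.
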